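(* Let $m_2,m_3\in\mathbb{N}$ and let $(U,V)$ be bivariate (jointly) Gaussian random variables with $U\sim N(0,1)$ and $V\sim N(0,1)$. (i) We have $$E[U^{2m_2}V^{2m_3}]\le \frac{E[U^{2m_2+2}V^{2m_3}]}{2m_2+1},$$ and equality holds if and only if $U$ and $V$ are independent. (ii) Suppose that $m_3\le m_2$. Then $$\left|E[U^{2m_2+1}V^{2m_3-1}]\right|<\frac{2m_2+1}{2m_3}\,E[U^{2m_2}V^{2m_3}].$$
   Context: $\mathbb{N}=\{1,2,3,\dots\}$. The correlation $E[UV]\in[-1,1]$ is arbitrary (the joint law may be degenerate). *)

(* Defs.v *)
From HB Require Import structures.
From mathcomp Require Import all_boot all_order all_algebra.
From mathcomp Require Import all_classical all_reals all_analysis.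

Set Implicit Arguments.
Unset Strict Implicit.
Unset Printing Implicit Defensive.
Import Order.TTheory GRing.Theory Num.Theory.

Local Open Scope classical_set_scope.
Local Open Scope ring_scope.

(* The law N(m, s^2), parametrized by the standard deviation s; N(m, 0) is the
   Dirac mass at m.  The case s = 0 is treated apart because [normal_prob m 0]
   is by convention the uniform law on [0, 1]. *)
Definition gaussian_law (R : realType) (m s : R) (A : set R) : \bar R :=
  if s == 0 then \d_m A else normal_prob m s A.

(* Laws are compared on measurable (Borel) sets only: the underlying set
   functions carry no information on the other sets. *)
Definition has_gaussian_law (d : measure_display) (T : measurableType d)
    (R : realType) (P : probability T R) (X : T -> R) (m s : R) : Prop :=
  forall A : set R, measurable A -> P (X @^-1` A) = gaussian_law m s A.

Definition jointly_gaussian (d : measure_display) (T : measurableType d)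
    (R : realType) (P : probability T R) (X Y : T -> R) : Prop :=
  forall a b : R, exists m s : R,
    0 <= s /\ has_gaussian_law P (fun w => a * X w + b * Y w) m s.

Definition independent_RVs (d : measure_display) (T : measurableType d)
    (R : realType) (P : probability T R) (X Y : T -> R) : Prop :=
  forall A B : set R, measurable A -> measurable B ->
    P ((X @^-1` A) `&` (Y @^-1` B)) = (P (X @^-1` A) * P (Y @^-1` B))%E.

(* Main.v *)
(* Write M i j = E[U^i V^j] and r = M 1 1.  Every x U + V is centred Gaussian of
   variance x^2 + 2 r x + 1, so the moment recurrence of Gaussian laws gives a
   polynomial identity in x; differentiating it and comparing coefficients
   yields Isserlis' recurrence
     M (i+1) j = i M (i-1) j + j r M i (j-1),
   and its mirror image.  Hence M (2p) (2q) > 0 and M (2p+1) (2q+1) is r times a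
   positive number, so that
     M (2p+2) (2q) - (2p+1) M (2p) (2q) = 2 q r M (2p+1) (2q-1)
   is r^2 times a positive number: this is (i), with equality iff r = 0.  Part
   (ii) follows from both recurrences by induction, after changing the sign of V
   to make r nonnegative.

   Independence clearly forces r = 0.  Conversely, if r = 0 then
   E[cos(a U + b) cos(a' V + b')] factorizes, because the law of each linear
   combination is known.  Hence so does E[f(U) g(V)] for trigonometric
   polynomials f and g, and, by bounded limits, for indicators of half-lines; a
   Dynkin argument concludes. *)

Require Import Defs.
From HB Require Import structures.
From mathcomp Require Import all_boot all_order all_algebra.
From mathcomp Require Import all_classical all_reals all_analysis.
From mathcomp Require Import measurable_realfun.
From mathcomp Require Import ring lra.

Set Implicit Arguments.
Unset Strict Implicit.
Unset Printing Implicit Defensive.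
Import Order.TTheory GRing.Theory Num.Theory.
Import numFieldNormedType.Exports.

Local Open Scope classical_set_scope.
Local Open Scope ring_scope.

(** * Consequences of the moment recurrence *)

Section moment_recurrence.
Variables (R : realFieldType) (r : R) (M : nat -> nat -> R).
Hypothesis M00 : 0 < M 0 0.
Hypothesis recl : forall i j,
  M i.+1 j = i%:R * M i.-1 j + j%:R * r * M i j.-1.
Hypothesis recr : forall i j,
  M i j.+1 = j%:R * M i j.-1 + i%:R * r * M i.-1 j.

(** Induction on [p]. The odd moment that enters an even one already carries a factor [r], so [r]
    enters the even moments only squared and cannot spoil positivity, whatever its sign. *)
Lemma moments_parity p q : 0 < M p.*2 q.*2 /\
  exists2 c, 0 < c & M p.*2.+1 q.*2.+1 = r * c.
Proof.
elim: p q => [|p IH] q.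
  have M0q k : 0 < M 0 k.*2.
    elim: k => [//|k IHk]; rewrite doubleS recr /= !mul0r addr0.
    by rewrite mulr_gt0// ltr0n.
  split=> //; exists (q.*2.+1%:R * M 0 q.*2); first by rewrite mulr_gt0 ?ltr0n.
  by rewrite recl/= mul0r add0r mulrAC mulrC.
have pos k : 0 < M p.+1.*2 k.*2.
  rewrite doubleS recl/=; apply: ltr_wpDr; last first.
    by rewrite mulr_gt0 ?ltr0n//; exact: (IH k).1.
  case: k => [|k]; first by rewrite !mul0r.
  have [_ [c c0 /= ->]] := IH k.
  by rewrite -!mulrA mulr_ge0// mulrA mulr_ge0 ?(ltW c0)// -expr2 sqr_ge0.
split=> //; have [_ [c c0 Ec]] := IH q.
exists (p.*2.+2%:R * c + q.*2.+1%:R * M p.+1.*2 q.*2).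
  by rewrite addr_gt0 // mulr_gt0 ?ltr0n.
by rewrite doubleS recl/= Ec; ring.
Qed.

(** [recl] with the odd moment of [moments_parity] substituted. This exact form of the gap in (i)
    yields the equality case together with the inequality. *)
Lemma even_moment_step p q : exists2 c, 0 < c &
  M p.*2.+2 q.*2.+2 = p.*2.+1%:R * M p.*2 q.*2.+2 + r ^+ 2 * c.
Proof.
have [_ [c c0 E]] := moments_parity p q.
exists (q.*2.+2%:R * c); first by rewrite mulr_gt0 ?ltr0n.
by rewrite recl/= E; ring.
Qed.

Hypotheses (r0 : 0 <= r) (r1 : r <= 1).

Let odd_ge0 p q : 0 <= M p.*2.+1 q.*2.+1.
Proof. by have [_ [c c0 ->]] := moments_parity p q; rewrite mulr_ge0// ltW. Qed.

Let even_gt0 p q : 0 < M p.*2 q.*2. Proof. exact: (moments_parity p q).1. Qed.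

(** Induction on [q]. [recr] splits the left side in two; once the induction hypothesis bounds the
    first term, both add up to [q.+1.*2.+1] copies of [p.*2.+1%:R * r * M p.*2 q.+1.*2], which
    [a_ge] absorbs. *)
Lemma odd_moment_le_cor p q :
  M p.*2.+1 q.*2.+1 <= p.*2.+1%:R * r * M p.*2 q.*2.+2.
Proof.
have a_ge k : k.*2.+1%:R * M p.*2 k.*2 <= M p.*2 k.*2.+2.
  rewrite [leRHS]recr /= lerDl; case: p => [|p']; first by rewrite !mul0r.
  by rewrite !mulr_ge0//; exact: odd_ge0.
elim: q => [|q IH].
  rewrite recr/= mul0r add0r ler_wpM2l ?mulr_ge0 ?ler0n//.
  by apply: le_trans (a_ge 0%N); rewrite mul1r.
rewrite recr/=; apply: (@le_trans _ _
  (p.*2.+1%:R * r * (q.+1.*2.+1%:R * M p.*2 q.+1.*2))); last first.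
  by rewrite ler_wpM2l ?mulr_ge0 ?ler0n.
rewrite -[q.+1.*2.+1%:R]natr1 [(_ + 1) * _]mulrDl mul1r mulrDr lerD2r mulrCA.
by rewrite ler_wpM2l// ?ler0n//.
Qed.

(* Put P = 2p and Q = 2q + 2, so that the claim reads
   [Q * M (P+1) (Q-1) < (P+1) * M P Q].  If Q r < 1 it follows from
   [odd_moment_le_cor].  Otherwise the induction hypothesis gives
   [M (P-1) (Q-1) <= M P (Q-2)]; expanding both sides once along the
   recurrences, the difference is positive when Q <= (P+1) r, and else at least
   [M P (Q-2) * (P+1-Q) * ((P+Q) r - 1)], where (P+Q) r >= 2 Q r > 1. *)
Lemma odd_moment_lt p q : (q < p)%N ->
  q.*2.+2%:R * M p.*2.+1 q.*2.+1 < p.*2.+1%:R * M p.*2 q.*2.+2.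
Proof.
have small k l : l.*2.+2%:R * r < 1 ->
    l.*2.+2%:R * M k.*2.+1 l.*2.+1 < k.*2.+1%:R * M k.*2 l.*2.+2.
  move=> Qr; have a0 : 0 < k.*2.+1%:R * M k.*2 l.*2.+2.
    by rewrite mulr_gt0 ?ltr0n// -doubleS even_gt0.
  apply: (@le_lt_trans _ _ (l.*2.+2%:R * r * (k.*2.+1%:R * M k.*2 l.*2.+2))).
    rewrite -[leRHS]mulrA ler_wpM2l ?ler0n//.
    by rewrite mulrA [r * _]mulrC odd_moment_le_cor.
  by rewrite -[ltRHS]mul1r ltr_pM2r.
elim: p q => [//|p IH] q; rewrite ltnS => qp.
have [/small //|Qr] := ltP (q.*2.+2%:R * r) 1.
(* The induction hypothesis, weakened to a non-strict inequality. For [q = 0] the factor [q.*2%:R]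
   annihilates the truncated index [q.*2.-1]. *)
have : q.*2%:R * M p.*2.+1 q.*2.-1 <= p.*2.+1%:R * M p.*2 q.*2.
  case: q qp {Qr} => [|q] qp; last exact/ltW/IH.
  by rewrite mul0r mulr_ge0 ?ler0n// ltW// even_gt0.
have [A0 C0] := (even_gt0 p.+1 q, even_gt0 p q).
have B0 := odd_ge0 p q.
have := recl p.*2.+1 q.*2; have := recr p.*2.+1 q.*2.
rewrite doubleS in A0 *; rewrite [M p.*2.+3 _]recl [M _ q.*2.+2]recr/=.
move=> EB EA DC; move: DC EB EA A0 B0 C0 Qr.
have : (q.*2%:R <= p.*2%:R :> R) by rewrite ler_nat leq_double.
have Q0 : 0 <= q.*2%:R :> R by rewrite ler0n.
rewrite -[p.*2.+3%:R]natr1 -[p.*2.+2%:R]natr1 -[p.*2.+1%:R]natr1.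
rewrite -[q.*2.+2%:R]natr1 -[q.*2.+1%:R]natr1.
(* The claim is now at [p.+1], so [P] and [Q] are both 2 smaller than in the comment above the
   lemma. *)
move: (p.*2%:R : R) (q.*2%:R : R) Q0 => P Q Q0 QP.
move: (M p.*2 q.*2) (M p.*2.+1 q.*2.-1) (M p.*2.+2 q.*2) (M p.*2.+1 q.*2.+1).
move=> C D A B DC EB EA A0 B0 C0 Qr.
have BA : B <= A.
  rewrite -subr_ge0 (_ : A - B = (1 - r) * ((P + 1) * C - Q * D)).
    by rewrite mulr_ge0// subr_ge0.
  by rewrite EA EB; ring.
have Qr' : (Q + 1 + 1) * r <= Q + 1 + 1 by rewrite ler_piMr//; lra.
rewrite -subr_gt0 (_ : _ - _ = A * ((Q + 1) * (P + 3 - (Q + 2) * r)) -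
  B * ((P + 2) * (Q + 2 - (P + 3) * r))); last by ring.
have [QrP|QrP] := leP (Q + 2) ((P + 3) * r).
  apply: ltr_wpDr; first by rewrite -mulrN mulr_ge0// -mulrN mulr_ge0//; lra.
  by rewrite mulr_gt0// mulr_gt0//; lra.
have : B * ((P + 2) * (Q + 2 - (P + 3) * r)) <=
       A * ((P + 2) * (Q + 2 - (P + 3) * r)).
  by rewrite ler_wpM2r// mulr_ge0//; lra.
suff : 0 < A * ((Q + 1) * (P + 3 - (Q + 2) * r)) -
           A * ((P + 2) * (Q + 2 - (P + 3) * r)) by lra.
rewrite (_ : _ - _ = A * ((P + 1 - Q) * ((P + Q + 4) * r - 1))); last by ring.
rewrite mulr_gt0// mulr_gt0//; first by lra.
suff : 0 <= (P - Q) * r by lra.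
by rewrite mulr_ge0//; lra.
Qed.

End moment_recurrence.

Lemma norm_odd_moment_lt (R : realFieldType) (r : R) (M : nat -> nat -> R) p q :
  0 < M 0 0 ->
  (forall i j, M i.+1 j = i%:R * M i.-1 j + j%:R * r * M i j.-1) ->
  (forall i j, M i j.+1 = j%:R * M i j.-1 + i%:R * r * M i.-1 j) ->
  `|r| <= 1 -> (q < p)%N ->
  q.*2.+2%:R * `|M p.*2.+1 q.*2.+1| < p.*2.+1%:R * M p.*2 q.*2.+2.
Proof.
move=> M00 recl recr r1 qp.
(* the moments of (U, sV), with s the sign of r *)
pose s : R := (-1) ^+ (r < 0)%R.
have ss : s * s = 1 by rewrite -expr2 sqrr_sign.
have rE : `|r| = s * r by rewrite normrEsign.
pose N i j := s ^+ j * M i j.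
have N00 : 0 < N 0 0 by rewrite /N mul1r.
have reclN i j : N i.+1 j = i%:R * N i.-1 j + j%:R * `|r| * N i j.-1.
  rewrite /N recl rE; case: j => [|j] /=; first by rewrite !mul0r; ring.
  rewrite exprS mulrDr; congr (_ + _); first by ring.
  by ring.
have recrN i j : N i j.+1 = j%:R * N i j.-1 + i%:R * `|r| * N i.-1 j.
  rewrite /N recr rE exprS mulrDr; congr (_ + _); last by ring.
  case: j => [|j]; rewrite ?mul0r ?mulr0// exprS/= -[s * _ * _]mulrA.
  by ring: ss.
have := odd_moment_lt N00 reclN recrN (normr_ge0 _) r1 qp.
have [_ [c c0 E]] := moments_parity N00 reclN recrN p q.
have s_even k : s ^+ k.*2 = 1 by rewrite -mul2n exprM expr2 ss expr1n.
have -> : `|M p.*2.+1 q.*2.+1| = N p.*2.+1 q.*2.+1.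
  rewrite -[RHS]ger0_norm; last by rewrite E mulr_ge0// ltW.
  by rewrite /N normrM normrX normr_sign expr1n mul1r.
by rewrite /N -doubleS s_even mul1r.
Qed.

(** * Gaussian laws *)

(** Change of variables from agreement of the laws on measurable sets only, the form in which
    [has_gaussian_law] supplies it. Both sides are split into positive and negative parts, so a
    non-integrable [f] is covered too. *)
Lemma integral_law d d' (T : measurableType d) (T' : measurableType d')
    (R : realType) (P : probability T R) (X : T -> T')
    (nu : {measure set T' -> \bar R}) (f : T' -> \bar R) :
    measurable_fun [set: T] X ->
    (forall A, measurable A -> P (X @^-1` A) = nu A) ->
    measurable_fun [set: T'] f ->
  (\int[P]_w f (X w) = \int[nu]_x f x)%E.
Proof.
move=> mX lawX mf.
have ge0_law (g : T' -> \bar R) : measurable_fun [set: T'] g ->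
    (forall x, 0 <= g x)%E -> (\int[P]_w g (X w) = \int[nu]_x g x)%E.
  move=> mg g0; pose Y : {RV P >-> T'} := mfun_Sub (mem_set mX : X \in mfun).
  rewrite -(ge0_integral_distribution Y mg g0).
  by apply: eq_measure_integral => A mA _; exact: lawX.
rewrite [LHS]integralE [RHS]integralE -!ge0_law//; last 2 first.
- exact: measurable_funeneg.
- exact: measurable_funepos.
by congr (_ - _)%E; apply: eq_integral => w _; rewrite ?funeposE ?funenegE.
Qed.

Lemma integrable_law d d' (T : measurableType d) (T' : measurableType d')
    (R : realType) (P : probability T R) (X : T -> T')
    (nu : {measure set T' -> \bar R}) (f : T' -> \bar R) :
    measurable_fun [set: T] X ->
    (forall A, measurable A -> P (X @^-1` A) = nu A) ->
    nu.-integrable [set: T'] f ->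
  P.-integrable [set: T] (fun w => f (X w)).
Proof.
move=> mX lawX /integrableP[mf foo]; apply/integrableP; split.
  exact: (measurableT_comp mf mX).
by rewrite (integral_law (f := abse \o f) mX lawX)//; exact: measurableT_comp.
Qed.

(** The Radon-Nikodym derivative of [normal_prob] agrees almost everywhere with [normal_pdf],
    because both have the same integral over every measurable set. *)
Lemma ge0_integral_normal_prob (R : realType) (m s : R) (f : R -> \bar R) :
    measurable_fun [set: R] f -> (forall x, 0 <= f x)%E ->
  (\int[normal_prob m s]_x f x =
   \int[lebesgue_measure]_x (f x * (normal_pdf m s x)%:E))%E.
Proof.
move=> mf f0; have dom := @normal_prob_dominates R m s.
rewrite -(Radon_Nikodym_SigmaFinite.change_of_variables dom)//.
have mRN := Radon_Nikodym_SigmaFinite.f_integrable dom.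
have mpdf : measurable_fun [set: R] (fun x => (normal_pdf m s x)%:E).
  by apply/measurable_EFinP; exact: measurable_normal_pdf.
apply: ge0_ae_eq_integral => //.
- by apply: emeasurable_funM => //; exact: (measurable_int _ mRN).
- exact: emeasurable_funM.
- by move=> x _; rewrite mule_ge0// Radon_Nikodym_SigmaFinite.f_ge0.
- by move=> x _; rewrite mule_ge0// lee_fin normal_pdf_ge0.
- apply: ae_eqe_mul2l; apply: integral_ae_eq => // E _ mE.
  by rewrite -Radon_Nikodym_SigmaFinite.f_integral.
Qed.

Lemma integral_normal_prob (R : realType) (m s : R) (f : R -> \bar R) :
    measurable_fun [set: R] f ->
  (\int[normal_prob m s]_x f x =
   \int[lebesgue_measure]_x (f x * (normal_pdf m s x)%:E))%E.
Proof.
move=> mf; rewrite [LHS]integralE [RHS]integralE.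
have pdf0 x : (0 <= (normal_pdf m s x)%:E)%E by rewrite lee_fin normal_pdf_ge0.
rewrite !ge0_integral_normal_prob//; last 2 first.
- exact: measurable_funeneg.
- exact: measurable_funepos.
congr (_ - _)%E; apply: eq_integral => x _; rewrite ?funeposE ?funenegE.
  by rewrite muleC maxeMr// mule0 [in RHS]muleC.
by rewrite muleC maxeMr// mule0 muleN [in RHS]muleC.
Qed.

Lemma integrable_normal_prob (R : realType) (m s : R) (f : R -> \bar R) :
    measurable_fun [set: R] f ->
    lebesgue_measure.-integrable [set: R]
      (fun x => f x * (normal_pdf m s x)%:E)%E ->
  (normal_prob m s).-integrable [set: R] f.
Proof.
move=> mf /integrableP[_ foo]; apply/integrableP; split => //.
rewrite (@integral_normal_prob _ _ _ (abse \o f)); last exact: measurableT_comp.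
under eq_integral => x _ do
  rewrite -[X in (_ * X)%E]gee0_abs ?lee_fin ?normal_pdf_ge0// -abseM.
exact: foo.
Qed.

Lemma exprn_le_expR (R : realType) (x : R) n :
  0 <= x -> x ^+ n <= n`!%:R * expR x.
Proof.
move=> x0; case: n => [|n]; first by rewrite mul1r expr0 -expR0 ler_expR.
rewrite mulrC -ler_pdivrMr ?ltr0n ?fact_gt0//.
by apply: le_trans (expR_ge1Dxn n x0); rewrite lerDr.
Qed.

Lemma expR_norm_le (R : realType) (x : R) : expR `|x| <= expR x + expR (- x).
Proof.
have [x0|x0] := ger0P x; first by rewrite lerDl expR_ge0.
by rewrite lerDr expR_ge0.
Qed.

(** * Central moments of a nondegenerate normal density *)

Section normal_pdf_moments.
Variables (R : realType) (m s : R).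
Hypothesis s0 : s != 0.
Notation mu := (@lebesgue_measure R).

Lemma is_derive_normal_pdf (x : R) :
  is_derive x 1 (normal_pdf m s : R -> R)
    (- ((x - m) / s ^+ 2) * normal_pdf m s x).
Proof.
rewrite normal_pdfE//.
have h : is_derive x 1 (fun y : R => - (y - m) ^+ 2 / (s ^+ 2 *+ 2))
    (- ((x - m) / s ^+ 2)).
  by apply: is_derive_eq; rewrite /GRing.scale/=; field; exact: s0.
have k := is_derive_expR (- (x - m) ^+ 2 / (s ^+ 2 *+ 2)).
have c : is_derive x 1 (normal_fun m s)
    (normal_fun m s x * - ((x - m) / s ^+ 2)).
  exact: (@is_derive1_comp R expR
    (fun y : R => - (y - m) ^+ 2 / (s ^+ 2 *+ 2)) x _ _ k h).
by apply: is_derive_eq; rewrite /GRing.scale /=; ring.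
Qed.

(** Integration by parts in disguise: [f n] is the derivative of [F n], and its integral being 0 is
    the moment recurrence. At [n = 0] the term in [n.-1] has coefficient 0. *)
Let F n (x : R) : R := (x - m) ^+ n * normal_pdf m s x.
Let f n (x : R) : R :=
  (n%:R * (x - m) ^+ n.-1 - (x - m) ^+ n.+1 / s ^+ 2) * normal_pdf m s x.

Let is_derive_F n (x : R) : is_derive x 1 (F n : R -> R) (f n x).
Proof.
have h := is_derive_normal_pdf x.
have hp : is_derive x 1 (fun y : R => (y - m) ^+ n) (n%:R * (x - m) ^+ n.-1).
  have hb : is_derive x 1 (fun y : R => y - m) 1.
    by apply: is_derive_eq; rewrite subr0.
  have := is_deriveX n hb; rewrite exprfctE => /is_derive_eq; apply.
  by rewrite /GRing.scale/= mulr1.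
have := is_deriveM hp h => /is_derive_eq; apply.
by rewrite /f /GRing.scale/= [(x - m) ^+ n.+1]exprS; ring.
Qed.

Let continuous_poly_pdf (p : {poly R}) :
  continuous (fun x : R => p.[x - m] * normal_pdf m s x).
Proof.
move=> x; apply: cvgM; last exact: continuous_normal_pdf.
apply: (@continuous_comp _ _ _ (fun y => y - m) (fun y => p.[y])).
  by apply: (@cvgB _ R^o); [exact: cvg_id|exact: cvg_cst].
exact: continuous_horner.
Qed.

Let continuous_f n : continuous (f n).
Proof.
pose p : {poly R} := n%:R *: 'X^(n.-1) - (s ^+ 2)^-1 *: 'X^(n.+1).
have -> : f n = fun x => p.[x - m] * normal_pdf m s x.
  by apply/funext => x; rewrite /f /p !hornerE; ring.
exact: continuous_poly_pdf.
Qed.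

Let FTC n (y : R) : 0 < y ->
  (\int[mu]_(x in `[(m - y)%R, (m + y)%R]) (f n x)%:E =
   (F n (m + y) - F n (m - y))%:E)%E.
Proof.
move=> y0; rewrite EFinB; apply: continuous_FTC2.
- by rewrite ltrD2l gtrN.
- by apply: continuous_subspaceT; exact: continuous_f.
- split.
  + by move=> x _; apply: ex_derive.
  + apply: cvg_at_right_filter.
    by apply/differentiable_continuous/derivable1_diffP; apply: ex_derive.
  + apply: cvg_at_left_filter.
    by apply/differentiable_continuous/derivable1_diffP; apply: ex_derive.
- by move=> x _; rewrite derive1E; apply: derive_val.
Qed.

(** Completing the square: the tilted density is a constant times the normal density of mean
    [m + t * s ^+ 2]. *)
Lemma integral_expR_normal_pdf t :
  (\int[mu]_x (expR (t * (x - m)) * normal_pdf m s x)%:E =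
   (expR (t ^+ 2 * s ^+ 2 / 2))%:E)%E.
Proof.
have E x : expR (t * (x - m)) * normal_pdf m s x =
    expR (t ^+ 2 * s ^+ 2 / 2) * normal_pdf (m + t * s ^+ 2) s x.
  rewrite !normal_pdfE// mulrCA [RHS]mulrCA; congr (_ * _).
  rewrite -!expRD; congr expR; field; exact: s0.
under eq_integral do rewrite E EFinM.
rewrite ge0_integralZl//; last 2 first.
- by apply/measurable_EFinP; exact: measurable_normal_pdf.
- by move=> x _; rewrite lee_fin normal_pdf_ge0.
- by rewrite integral_normal_pdf mule1.
Qed.

Lemma integrable_expR_normal_pdf t :
  mu.-integrable [set: R] (fun x => (expR (t * (x - m)) * normal_pdf m s x)%:E).
Proof.
apply/integrableP; split.
  apply/measurable_EFinP; apply: measurable_funM;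
    last exact: measurable_normal_pdf.
  apply: measurableT_comp => //; apply: measurable_funM => //.
  exact: measurable_funB.
under eq_integral => x _.
  rewrite gee0_abs; last by rewrite lee_fin mulr_ge0 ?expR_ge0 ?normal_pdf_ge0.
  over.
by rewrite integral_expR_normal_pdf ltry.
Qed.

Let measurable_F n : measurable_fun [set: R] (F n).
Proof.
apply: measurable_funM; last exact: measurable_normal_pdf.
by apply: measurable_funX; exact: measurable_funB.
Qed.

(** Domination by n! (exp(x - m) + exp(m - x)) times the density, that is, by the exponential
    moments at t = 1 and t = -1. *)
Lemma integrable_exprn_normal_pdf n :
  mu.-integrable [set: R] (fun x => ((x - m) ^+ n * normal_pdf m s x)%:E).
Proof.
pose g x := ((n`!%:R)%:E * ((expR (1 * (x - m)) * normal_pdf m s x)%:E +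
  (expR (-1 * (x - m)) * normal_pdf m s x)%:E))%E.
have ig : mu.-integrable [set: R] g.
  by apply: integrableZl => //; apply: integrableD => //;
    exact: integrable_expR_normal_pdf.
apply: le_integrable ig => //.
  by apply/measurable_EFinP; exact: measurable_F.
move=> x _; rewrite /g -EFinD -EFinM lee_fin -mulrDl mul1r mulN1r mulrA.
have pdf0 := normal_pdf_ge0 m s x.
have e0 : 0 <= n`!%:R * (expR (x - m) + expR (- (x - m))).
  by rewrite mulr_ge0// addr_ge0// expR_ge0.
rewrite [leRHS]ger0_norm; last exact: mulr_ge0.
rewrite normrM normrX [`|normal_pdf _ _ _|]ger0_norm// ler_wpM2r//.
apply: le_trans (exprn_le_expR _ (normr_ge0 _)) _.
by rewrite ler_wpM2l// expR_norm_le.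
Qed.

Let integrable_f n : mu.-integrable [set: R] (EFin \o f n).
Proof.
pose g x := (n%:R%:E * ((x - m) ^+ n.-1 * normal_pdf m s x)%:E -
  (s ^+ 2)^-1%:E * ((x - m) ^+ n.+1 * normal_pdf m s x)%:E)%E.
have ig : mu.-integrable [set: R] g.
  by apply: integrableB => //; apply: integrableZl => //;
    exact: integrable_exprn_normal_pdf.
apply: eq_integrable ig => // x _.
by rewrite /g /f /= -!EFinM -EFinB; congr EFin; ring.
Qed.

Let F_bound n : exists2 C, 0 <= C &
  forall y, 1 <= `|y| -> `|F n (m + y)| <= C / `|y|.
Proof.
pose c := s ^+ 2 *+ 2.
have c0 : 0 < c by rewrite pmulrn_rgt0// exprn_even_gt0.
exists (normal_peak s * (n.+1`!%:R * c ^+ n.+1)).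
  by rewrite !mulr_ge0 ?normal_peak_ge0// exprn_ge0// ltW.
move=> y y1; have y0 : 0 < `|y| by exact: lt_le_trans y1.
rewrite ler_pdivlMr// /F normal_pdfE// addrC addKr.
rewrite !normrM normrX [`|normal_peak s|]ger0_norm ?normal_peak_ge0//.
rewrite [`|normal_fun _ _ _|]ger0_norm ?normal_fun_ge0//.
rewrite mulrAC -exprSr mulrCA ler_wpM2l ?normal_peak_ge0//.
rewrite /normal_fun [m + y - m]addrC addKr mulNr expRN ler_pdivrMr ?expR_gt0//.
(* As |y| >= 1, the exponent may be doubled; the power becomes one of y^2 / c, which the series of
   exp(y^2 / c) dominates. *)
apply: (@le_trans _ _ (`|y| ^+ (2 * n.+1))).
  by rewrite ler_weXn2l// leq_pmull.
rewrite exprM -normrX ger0_norm ?sqr_ge0//.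
have -> : (y ^+ 2) ^+ n.+1 = c ^+ n.+1 * (y ^+ 2 / c) ^+ n.+1.
  by rewrite -exprMn mulrCA divff ?mulr1// gt_eqF.
rewrite [leRHS]mulrAC [leRHS]mulrC ler_wpM2l ?exprn_ge0 ?(ltW c0)//.
by rewrite exprn_le_expR// mulr_ge0// ?sqr_ge0// invr_ge0 ltW.
Qed.

(* f n is the derivative of F n, which vanishes at infinity *)
Let Rintegral_f n : \int[mu]_x f n x = 0.
Proof.
pose D k : set R := `[(m - k.+1%:R)%R, (m + k.+1%:R)%R]%classic.
have mf : measurable_fun [set: R] (f n).
  by apply: continuous_measurable_fun; exact: continuous_f.
have cvg_int : (\int[mu]_(x in D k) (f n x)%:E)%E @[k --> \oo] -->
    (\int[mu]_x (f n x)%:E)%E.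
  have := @dominated_convergence _ _ _ mu setT measurableT
    (fun k => (EFin \o f n) \_ (D k)) (EFin \o f n) (fun x => `|(f n x)%:E|%E).
  case => //.
  - move=> k; apply: (measurable_restrictT _ _).1; first exact: measurable_itv.
    apply: measurable_funTS; apply/measurable_EFinP; exact: mf.
  - by apply/measurable_EFinP; exact: mf.
  - apply: aeW => x _.
    apply: cvg_near_cst; near=> k; rewrite patchE ifT// inE /D/= in_itv/=.
    have : `|x - m| <= k%:R by near: k; exact: nbhs_infty_ger.
    by rewrite ler_norml -[k.+1%:R]natr1 => /andP[? ?]; apply/andP; split; lra.
  - exact: integrable_abse (integrable_f n).
  - apply: aeW => x k _; rewrite patchE; case: ifP => _ //.
    by rewrite abse0 abse_ge0.
  - move=> _ _.
    by under eq_fun do rewrite -integral_mkcond.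
suff cvg0 : (\int[mu]_(x in D k) (f n x)%:E)%E @[k --> \oo] --> 0%:E.
  by rewrite /Rintegral (cvg_unique _ cvg_int cvg0).
have [C C0 FC] := F_bound n.
under eq_fun => k do rewrite FTC//.
apply: cvg_EFin; first exact: nearW.
have cvgC c : c * harmonic k @[k --> \oo] --> (0 : R).
  by rewrite -[X in _ --> X](mulr0 c); apply: cvgMr; exact: cvg_harmonic.
apply: (squeeze_cvgr _ (cvgC (- (2 * C))) (cvgC (2 * C))).
apply: nearW => k /=; rewrite mulNr -ler_norml /harmonic.
have k1 : 1 <= `|k.+1%:R : R| by rewrite normr_nat ler1n.
have k1N : 1 <= `|- k.+1%:R : R| by rewrite normrN.
have := lerD (FC _ k1) (FC _ k1N); rewrite normrN normr_nat -mulrDl.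
by move=> /(le_trans (ler_normB _ _)); rewrite [2 * C]mulr_natl mulr2n.
Unshelve. all: by end_near.
Qed.

Lemma Rintegral_exprn_normal_pdf n :
  \int[mu]_x ((x - m) ^+ n.+1 * normal_pdf m s x) =
  n%:R * s ^+ 2 * \int[mu]_x ((x - m) ^+ n.-1 * normal_pdf m s x).
Proof.
have := Rintegral_f n.
have -> : \int[mu]_x f n x =
    \int[mu]_x (n%:R * ((x - m) ^+ n.-1 * normal_pdf m s x)
                - (s ^+ 2)^-1 * ((x - m) ^+ n.+1 * normal_pdf m s x)).
  by apply: eq_Rintegral => x _; rewrite /f; ring.
have i1 := integrable_exprn_normal_pdf n.-1.
have i2 := integrable_exprn_normal_pdf n.+1.
rewrite RintegralB//; last 2 first.
- exact: (integrableZl _ _ i1).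
- exact: (integrableZl _ _ i2).
rewrite !RintegralZl// => /eqP; rewrite subr_eq0 => /eqP E.
by rewrite [n%:R * _]mulrC -mulrA E mulVKf// sqrf_eq0.
Qed.

End normal_pdf_moments.

(** * Moments of a random variable of Gaussian law, possibly degenerate *)

Section gaussian_law.
Context d (T : measurableType d) (R : realType) (P : probability T R).
Variables (X : T -> R) (m s : R).
Hypotheses (mX : measurable_fun [set: T] X) (lawX : has_gaussian_law P X m s).

Let law_normal : s != 0 ->
  forall A : set (measurableTypeR R), measurable A ->
    P (X @^-1` A) = normal_prob m s A.
Proof. by move=> s0 A mA; rewrite lawX// /gaussian_law ifN. Qed.

Let law_dirac : s = 0 -> forall A, measurable A -> P (X @^-1` A) = \d_m A.
Proof. by move=> s0 A mA; rewrite lawX// /gaussian_law s0 eqxx. Qed.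

Lemma gaussian_integrable_expR t :
  P.-integrable [set: T] (fun w => (expR (t * (X w - m)))%:E).
Proof.
pose f (x : R) := (expR (t * (x - m)))%:E.
have mf : measurable_fun [set: R] f.
  apply/measurable_EFinP; apply: measurableT_comp => //.
  by apply: measurable_funM => //; exact: measurable_funB.
have [s0|s0] := eqVneq s 0.
  apply: (integrable_law (f := f) mX (law_dirac s0)).
  apply/integrableP; split => //.
  have mabsf : measurable_fun [set: R] (fun x => `|f x|)%E.
    exact: measurableT_comp.
  by rewrite (integral_dirac m measurableT mabsf) diracT mul1e ltry.
apply: (@integrable_law _ _ _ (measurableTypeR R) _ _ _
  (normal_prob m s) f) => //.
  exact: law_normal.
apply: integrable_normal_prob => //.
under eq_fun do rewrite -EFinM.
exact: integrable_expR_normal_pdf.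
Qed.

Lemma gaussian_integrable_expR_norm :
  P.-integrable [set: T] (fun w => (expR `|X w - m|)%:E).
Proof.
have := integrableD measurableT
  (gaussian_integrable_expR 1) (gaussian_integrable_expR (-1)).
apply: le_integrable => //.
  apply/measurable_EFinP; apply: measurableT_comp => //.
  by apply: measurableT_comp => //; exact: measurable_funB.
move=> w _; rewrite -EFinD lee_fin mul1r mulN1r.
by rewrite ger0_norm ?expR_ge0// ger0_norm ?expR_norm_le.
Qed.

Lemma gaussian_integrable_exprn n :
  P.-integrable [set: T] (fun w => ((X w - m) ^+ n)%:E).
Proof.
have := integrableZl measurableT n`!%:R gaussian_integrable_expR_norm.
apply: le_integrable => //.
  by apply/measurable_EFinP; apply: measurable_funX; exact: measurable_funB.
move=> w _; rewrite -EFinM lee_fin normrX [leRHS]ger0_norm.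
  exact: exprn_le_expR.
by rewrite mulr_ge0// expR_ge0.
Qed.

(** For a Dirac mass both sides vanish, the exponent on the left being positive; otherwise this is
    the recurrence for the density. *)
Lemma gaussian_moment n :
  \int[P]_w ((X w - m) ^+ n.+1) =
  n%:R * s ^+ 2 * \int[P]_w ((X w - m) ^+ n.-1).
Proof.
have mf k : measurable_fun [set: R] (fun x : R => ((x - m) ^+ k)%:E).
  by apply/measurable_EFinP; apply: measurable_funX; exact: measurable_funB.
have [s0|s0] := eqVneq s 0.
  rewrite s0 expr0n/= mulr0 mul0r /Rintegral.
  rewrite (integral_law mX (law_dirac s0) (mf n.+1)) integral_dirac//.
  by rewrite diracT mul1e subrr expr0n.
have E k : \int[P]_w ((X w - m) ^+ k) =
    \int[lebesgue_measure]_x ((x - m) ^+ k * normal_pdf m s x).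
  rewrite /Rintegral; congr fine.
  rewrite -(@integral_normal_prob _ m s (fun x => ((x - m) ^+ k)%:E))//.
  by apply: (@integral_law _ _ _ (measurableTypeR R)) => //;
    [exact: law_normal|exact: mf].
by rewrite !E Rintegral_exprn_normal_pdf.
Qed.

End gaussian_law.

(** * Joint moments *)

(** Otherwise the naturals below [size (p - q)] would be distinct roots of the nonzero [p - q], one
    more than its degree. *)
Lemma poly_eq_horner (R : realDomainType) (p q : {poly R}) :
  (forall x, p.[x] = q.[x]) -> p = q.
Proof.
move=> pq; apply/eqP; rewrite -subr_eq0; apply: contraT => pq0.
have := @max_poly_roots _ _ [seq i%:R | i <- iota 0 (size (p - q))] pq0.
rewrite size_map size_iota ltnn; apply.
- by apply/allP => x _; rewrite /root hornerD hornerN pq subrr.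
- rewrite map_inj_uniq ?iota_uniq// => i j /eqP; rewrite eqr_nat.
  by move/eqP.
Qed.

(* With M i j = E[U^i V^j], the hypothesis says
   E[(x U + V)^(n+1)] = n (x^2 + 2 r x + 1) E[(x U + V)^(n-1)]. *)
Lemma bivariate_moment_rec (R : realFieldType) (r : R) (M : nat -> nat -> R) :
    (forall n x, \sum_(i < n.+2) x ^+ i * M i (n.+1 - i)%N *+ 'C(n.+1, i) =
      n%:R * (x ^+ 2 + 2 * r * x + 1) *
      \sum_(i < n.-1.+1) x ^+ i * M i (n.-1 - i)%N *+ 'C(n.-1, i)) ->
  forall i j, M i.+1 j = i%:R * M i.-1 j + j%:R * r * M i j.-1.
Proof.
move=> E.
(* [G n] is E[(x U + V)^n] as a polynomial in x, and [q] is the variance of x U + V. *)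
pose G n : {poly R} := \poly_(i < n.+1) (M i (n - i)%N *+ 'C(n, i)).
pose q : {poly R} := 'X^2 + (2 * r)%:P * 'X + 1.
have GE n x : (G n).[x] = \sum_(i < n.+1) x ^+ i * M i (n - i)%N *+ 'C(n, i).
  by rewrite horner_poly; apply: eq_bigr => i _; rewrite mulrnAl mulrC -mulrnAr.
have GS n : G n.+1 = n%:R * q * G n.-1.
  apply: poly_eq_horner => x; rewrite !hornerM hornerMn GE E -GE /q.
  by rewrite !hornerE.
have G0 : G 0%N = (M 0 0)%:P.
  apply: poly_eq_horner => x.
  by rewrite GE big_ord_recl big_ord0 hornerC expr0 mul1r addr0.
have G1 : G 1%N = 0 by rewrite GS !mul0r.
have q' : q^`() = 2%:R * ('X + r%:P).
  rewrite /q !derivD derivXn derivM derivC derivX -polyC1 derivC/=.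
  by rewrite polyCM polyC_natr; ring.
have dN k : (k%:R : {poly R})^`() = 0 by rewrite -polyC_natr derivC.
(* Induction in steps of two: in the product rule for [GS], the derivative of the lower [G] brings
   back [q * G n], which is [G n.+2] up to the factor [n.+1]. *)
have G' n : (G n.+2)^`() = (n.+2 * n.+1)%:R * ('X + r%:P) * G n.
  have [k le_nk] := ubnP n; elim: k n le_nk => // k IH [|[|n]] le_nk.
  - by rewrite GS/= mul1r derivM G0 derivC mulr0 addr0 q'.
  - by rewrite GS /= G1 !mulr0 derivC.
  rewrite GS/= derivM derivM q' IH; last by rewrite -ltnS ltnW.
  by rewrite [G n.+2]GS /= dN !natrM; ring.
have GK n : (G n.+1)^`() =
    n.+1%:R *: \poly_(i < n.+1) (M i.+1 (n - i)%N *+ 'C(n, i)).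
  apply/polyP => i; rewrite coef_deriv coefZ !coef_poly ltnS.
  case: ifP => _; last by rewrite mul0rn mulr0.
  by rewrite subSS -!mulrnA mulr_natl -mulrnA mulnC -mul_bin_diag mulnC.
(* In expectations, E[U (x U + V)^(n+1)] = (n+1) (x + r) E[(x U + V)^n]. The recurrence is its
   coefficient of x^i. *)
have K n : \poly_(i < n.+2) (M i.+1 (n.+1 - i)%N *+ 'C(n.+1, i)) =
    n.+1%:R *: (('X + r%:P) * G n).
  have := G' n; rewrite GK.
  have -> : (n.+2 * n.+1)%:R * ('X + r%:P) * G n =
      n.+2%:R *: (n.+1%:R *: (('X + r%:P) * G n)).
    by rewrite -!mul_polyC !polyC_natr natrM !mulrA.
  by apply: scalerI; rewrite pnatr_eq0.
have M10 : M 1%N 0%N = 0.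
  by have /polyP/(_ 1%N) := G1; rewrite coef_poly coef0.
(* [K] reaches only i + j >= 1. The remaining case i = j = 0 says that U is centred, which comes
   from [G1]. *)
move=> i j; case: (posnP (i + j)) => [/eqP|].
  by rewrite addn_eq0 => /andP[/eqP-> /eqP->]; rewrite M10 !mul0r addr0.
case En : (i + j)%N => [//|n] _; have /polyP/(_ i) := K n.
have jE : j = (n.+1 - i)%N by rewrite -En addKn.
have in1 : (i < n.+2)%N by rewrite ltnS -En leq_addr.
have C0 : ('C(n.+1, i)%:R : R) != 0.
  by rewrite pnatr_eq0 -lt0n bin_gt0 -ltnS.
(* The multiplicity [(0 < i)] removes the term at [i = 0], where ['C(n, i.-1)] would be 1. *)
have Cl : i%:R * 'C(n.+1, i)%:R = n.+1%:R * 'C(n, i.-1)%:R *+ (0 < i)%N :> R.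
  case: (i) => [|k]; first by rewrite mul0r.
  by rewrite -!natrM mul_bin_diag.
have Cr : j%:R * 'C(n.+1, i)%:R = n.+1%:R * 'C(n, i)%:R :> R.
  by rewrite -!natrM mul_bin_down jE.
rewrite coef_poly in1 -jE coefZ mulrDl coefD coefXM coefCM /G !coef_poly.
(* At [i = n.+1], that is [j = 0], the binomial vanishes and the truncated [j.-1] does no harm. *)
have -> : (if (i < n.+1)%N then M i (n - i)%N *+ 'C(n, i) else 0) =
    M i j.-1 *+ 'C(n, i).
  case: ifPn => [le_in|]; first by rewrite jE subSn.
  by rewrite -leqNgt => ?; rewrite bin_small.
have -> : (if i == 0%N then 0 else
    if (i.-1 < n.+1)%N then M i.-1 (n - i.-1)%N *+ 'C(n, i.-1) else 0) =
    M i.-1 j *+ 'C(n, i.-1) *+ (0 < i)%N.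
  case: (i) in1 jE => [//|k] kn jE /=; rewrite -ltnS kn jE subSS //.
rewrite -[M i.+1 j *+ _]mulr_natr => Eij; apply: (mulIf C0); rewrite Eij.
rewrite mulrDr mulrDl; congr (_ + _).
  rewrite mulrAC Cl -[M _ _ *+ 'C(_, _)]mulr_natr.
  by case: (0 < i)%N; rewrite ?mulr0n ?mulr1n; ring.
rewrite -[M _ _ *+ 'C(_, _)]mulr_natr (_ : _ * _ * 'C(n.+1, i)%:R =
  (j%:R * 'C(n.+1, i)%:R) * (r * M i j.-1)); last by ring.
by rewrite Cr; ring.
Qed.

Lemma Rintegral_sum d (T : measurableType d) (R : realType)
    (mu : {measure set T -> \bar R}) (f : nat -> T -> R) n :
    (forall i, mu.-integrable [set: T] (EFin \o f i)) ->
  \int[mu]_w (\sum_(i < n) f i w) = \sum_(i < n) \int[mu]_w f i w.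
Proof.
move=> fi; elim: n => [|n IH].
  under eq_Rintegral do rewrite big_ord0.
  by rewrite big_ord0 Rintegral_cst// mul0r.
under eq_Rintegral do rewrite big_ord_recr.
rewrite RintegralD//; first by rewrite IH big_ord_recr.
have : mu.-integrable [set: T] (fun w => \sum_(i < n) (f i w)%:E)%E.
  by apply: integrable_sum => // i _; exact: fi.
by apply: eq_integrable => // w _; rewrite /= sumEFin.
Qed.

Section joint_moments.
Context d (T : measurableType d) (R : realType) (P : probability T R).

(** Domination by X^(2i) + Y^(2j), since 2 |a b| <= a^2 + b^2. *)
Lemma integrable_exprM (X Y : T -> R) i j :
    measurable_fun [set: T] X -> measurable_fun [set: T] Y ->
    P.-integrable [set: T] (fun w => (X w ^+ (2 * i))%:E) ->
    P.-integrable [set: T] (fun w => (Y w ^+ (2 * j))%:E) ->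
  P.-integrable [set: T] (fun w => (X w ^+ i * Y w ^+ j)%:E).
Proof.
move=> mX mY iX iY; have := integrableD measurableT iX iY.
apply: le_integrable => //.
  by apply/measurable_EFinP; apply: measurable_funM; exact: measurable_funX.
move=> w _; rewrite -EFinD lee_fin (mulnC _ i) (mulnC _ j) !exprM.
rewrite [leRHS]ger0_norm; last first.
  by rewrite addr_ge0 ?sqr_ge0.
by rewrite ler_norml; apply/andP; split; nra.
Qed.

Variables (U V : T -> R).
Hypotheses (mU : measurable_fun [set: T] U) (mV : measurable_fun [set: T] V).
Hypotheses (UV_gaussian : jointly_gaussian P U V)
  (U_std : has_gaussian_law P U 0 1) (V_std : has_gaussian_law P V 0 1).

Let integrable_std (X : T -> R) n :
  measurable_fun [set: T] X -> has_gaussian_law P X 0 1 ->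
  P.-integrable [set: T] (fun w => (X w ^+ n)%:E).
Proof.
move=> mX X_std; have := gaussian_integrable_exprn mX X_std n.
by apply: eq_integrable => // w _; rewrite subr0.
Qed.

Lemma integrable_joint_moment i j :
  P.-integrable [set: T] (fun w => (U w ^+ i * V w ^+ j)%:E).
Proof. by apply: integrable_exprM => //; exact: integrable_std. Qed.

Definition joint_moment i j : R := \int[P]_w (U w ^+ i * V w ^+ j).

Local Notation M := joint_moment.
Local Notation rho := (M 1 1).

Lemma joint_moment00 : M 0 0 = 1.
Proof.
rewrite /M; under eq_Rintegral do rewrite mulr1.
by rewrite Rintegral_cst//= probability_setT mulr1.
Qed.

Let std_moment (X : T -> R) n :
  measurable_fun [set: T] X -> has_gaussian_law P X 0 1 ->
  \int[P]_w (X w ^+ n.+1) = n%:R * \int[P]_w (X w ^+ n.-1).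
Proof.
move=> mX X_std; have := gaussian_moment mX X_std n.
rewrite expr1n mulr1; under eq_Rintegral do rewrite subr0.
by under [in RHS]eq_Rintegral do rewrite subr0.
Qed.

Let comb_expr (a b : R) n :
  \int[P]_w ((a * U w + b * V w) ^+ n) =
  \sum_(i < n.+1) a ^+ i * b ^+ (n - i) * M i (n - i)%N *+ 'C(n, i).
Proof.
pose f i w := (a ^+ i * b ^+ (n - i) *+ 'C(n, i)) * (U w ^+ i * V w ^+ (n - i)).
have fE w : (a * U w + b * V w) ^+ n = \sum_(i < n.+1) f i w.
  rewrite addrC exprDn; apply: eq_bigr => i _.
  by rewrite !exprMn /f mulrnAl; congr (_ *+ _); ring.
under eq_Rintegral do rewrite fE.
rewrite Rintegral_sum => [|i].
  apply: eq_bigr => i _; rewrite RintegralZl//;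
    last exact: integrable_joint_moment.
  by rewrite mulrnAl.
exact: (integrableZl measurableT _ (integrable_joint_moment i (n - i))).
Qed.

(** Joint Gaussianity only provides some mean and some deviation. They are identified by comparing
    the first two cases of [gaussian_moment] with the binomial expansion of the combination. *)
Lemma gaussian_comb_law (a b : R) : exists s,
  [/\ 0 <= s, has_gaussian_law P (fun w => a * U w + b * V w) 0 s &
     s ^+ 2 = a ^+ 2 + 2 * rho * a * b + b ^+ 2].
Proof.
have mS : measurable_fun [set: T] (fun w => a * U w + b * V w).
  by apply: measurable_funD; exact: measurable_funM.
have [m [s [s0 lawS]]] := UV_gaussian a b.
have iS1 : P.-integrable [set: T] (fun w => (a * U w + b * V w)%:E).
  have := integrableD measurableT
    (integrableZl measurableT a (integrable_joint_moment 1 0))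
    (integrableZl measurableT b (integrable_joint_moment 0 1)).
  by apply: eq_integrable => // w _; rewrite -!EFinM -EFinD; congr EFin; ring.
have U1 : M 1 0 = 0.
  rewrite /M; under eq_Rintegral do rewrite mulr1.
  by rewrite std_moment// mul0r.
have V1 : M 0 1 = 0.
  rewrite /M; under eq_Rintegral do rewrite mul1r.
  by rewrite std_moment// mul0r.
have U2 : M 2 0 = 1.
  rewrite /M; under eq_Rintegral do rewrite mulr1.
  rewrite std_moment// mul1r.
  by rewrite Rintegral_cst//= probability_setT mulr1.
have V2 : M 0 2 = 1.
  rewrite /M; under eq_Rintegral do rewrite mul1r.
  rewrite std_moment// mul1r.
  by rewrite Rintegral_cst//= probability_setT mulr1.
have m0 : m = 0.
  have := gaussian_moment mS lawS 0; rewrite !mul0r.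
  under eq_Rintegral do rewrite expr1.
  rewrite RintegralB//; last exact: finite_measure_integrable_cst.
  rewrite Rintegral_cst//= probability_setT mulr1.
  have := comb_expr a b 1; rewrite !big_ord_recl big_ord0 /= !expr1 U1 V1.
  under eq_Rintegral do rewrite expr1.
  move=> ->; rewrite !mulr0 !mul0rn !add0r.
  by move/eqP; rewrite oppr_eq0 => /eqP.
rewrite {}m0 in lawS; exists s; split => //.
have := gaussian_moment mS lawS 1; rewrite /= mul1r.
under eq_Rintegral do rewrite subr0.
rewrite [X in _ = _ * X]Rintegral_cst//= probability_setT !mulr1 => <-.
rewrite comb_expr !big_ord_recl big_ord0 /= U2 V2.
rewrite /bump/= !addn0 -[(1 + 1)%N]/2%N subn0 subnn -[(2 - 1)%N]/1%N.
by rewrite bin0 bin1 binn; ring.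
Qed.

Lemma integral_gaussian_comb (a b : R) n :
  \int[P]_w ((a * U w + b * V w) ^+ n.+1) =
  n%:R * (a ^+ 2 + 2 * rho * a * b + b ^+ 2) *
  \int[P]_w ((a * U w + b * V w) ^+ n.-1).
Proof.
have mS : measurable_fun [set: T] (fun w => a * U w + b * V w).
  by apply: measurable_funD; exact: measurable_funM.
have [s [_ lawS <-]] := gaussian_comb_law a b.
have := gaussian_moment mS lawS n; under eq_Rintegral do rewrite subr0.
by under [in RHS]eq_Rintegral do rewrite subr0.
Qed.

Lemma joint_moment_recl i j :
  M i.+1 j = i%:R * M i.-1 j + j%:R * rho * M i j.-1.
Proof.
apply: bivariate_moment_rec => n x.
have := integral_gaussian_comb x 1 n; rewrite !comb_expr expr1n mulr1.
under eq_bigr do rewrite expr1n mulr1.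
by under [in X in _ = X -> _]eq_bigr do rewrite expr1n mulr1.
Qed.
(** The variances 2 + 2 rho of U + V and 2 - 2 rho of U - V are squares. *)
Lemma joint_moment11_le1 : `|rho| <= 1.
Proof.
have [[s [_ _ Es]] [t [_ _ Et]]] :=
  (gaussian_comb_law 1 1, gaussian_comb_law 1 (-1)).
have := sqr_ge0 s; have := sqr_ge0 t; rewrite Es Et => ? ?.
by rewrite ler_norml; apply/andP; split; lra.
Qed.

End joint_moments.

(** * Independence *)

Lemma series_exp_coeff_le (R : realType) (x : R) n :
  0 <= x -> series (exp_coeff x) n <= expR x.
Proof.
move=> x0; rewrite /expR; apply: nondecreasing_cvgn_le.
  by apply: nondecreasing_series => k _ _; exact: exp_coeff_ge0.
exact: is_cvg_series_exp_coeff.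
Qed.

(** The first n cosine terms are, in absolute value, the even ones among the first 2n exponential
    terms at |x|. The bound is uniform in n, as dominated convergence requires. *)
Lemma norm_series_cos_coeff_le (R : realType) (x : R) n :
  `|series (cos_coeff' x) n| <= expR `|x|.
Proof.
apply: le_trans (series_exp_coeff_le n.*2 (normr_ge0 x)).
apply: le_trans (ler_norm_sum _ _ _) _.
elim: n => [|n IH]; first by rewrite /series/= !big_nil.
rewrite big_nat_recr//= /series/= doubleS 2?big_nat_recr//= -addrA lerD//.
rewrite ler_wpDr ?exp_coeff_ge0// /cos_coeff' /exp_coeff/=.
by rewrite !normrM normfV normr_nat !normrX normrN1 expr1n mul1r.
Qed.

(** The real characteristic function, summed from the moments: E[X^(2k)] = (2k)!/k! (s^2/2)^k turns
    the cosine series term by term into that of exp(-s^2/2), and exp|X| dominates the partial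
    sums. *)
Lemma gaussian_cos d (T : measurableType d) (R : realType)
    (P : probability T R) (X : T -> R) (s : R) :
    measurable_fun [set: T] X -> has_gaussian_law P X 0 s ->
  \int[P]_w cos (X w) = expR (- (s ^+ 2 / 2)).
Proof.
move=> mX lawX.
have iX n : P.-integrable [set: T] (fun w => (X w ^+ n)%:E).
  have := gaussian_integrable_exprn mX lawX n.
  by apply: eq_integrable => // w _; rewrite subr0.
have EX n : \int[P]_w (X w ^+ n.+1) = n%:R * s ^+ 2 * \int[P]_w (X w ^+ n.-1).
  have := gaussian_moment mX lawX n.
  under eq_Rintegral do rewrite subr0.
  by under [in RHS]eq_Rintegral do rewrite subr0.
have EX2 k : \int[P]_w (X w ^+ k.*2) = k.*2`!%:R / k`!%:R * (s ^+ 2 / 2) ^+ k.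
  elim: k => [|k IH].
    under eq_Rintegral do rewrite expr0.
    by rewrite Rintegral_cst//= probability_setT fact0 divr1 !mul1r.
  rewrite doubleS EX/= IH !factS !natrM.
  have -> : k.*2.+2%:R = 2 * k.+1%:R :> R by rewrite -doubleS -mul2n natrM.
  rewrite [_ ^+ k.+1]exprS; field.
  by rewrite nat1r !pnatr_eq0 -!lt0n fact_gt0.
have Ecoeff k : \int[P]_w cos_coeff' (X w) k = exp_coeff (- (s ^+ 2 / 2)) k.
  rewrite /cos_coeff' /exp_coeff /=.
  under eq_Rintegral do rewrite mulrAC.
  rewrite RintegralZl//; last exact: iX.
  rewrite EX2 exprNn -exprnP; field.
  by rewrite !pnatr_eq0 -!lt0n !fact_gt0.
have icoeff k : P.-integrable [set: T] (fun w => (cos_coeff' (X w) k)%:E).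
  have := integrableZl measurableT ((-1) ^+ k / k.*2`!%:R) (iX k.*2).
  by apply: eq_integrable => // w _; rewrite -EFinM mulrAC.
have Eseries n : (\int[P]_w (series (cos_coeff' (X w)) n)%:E =
    (series (exp_coeff (- (s ^+ 2 / 2))) n)%:E)%E.
  rewrite /series/= big_mkord; under eq_integral do rewrite big_mkord.
  have := @Rintegral_sum _ _ _ P (fun i w => cos_coeff' (X w) i) n icoeff.
  under [in X in _ = X -> _]eq_bigr do rewrite Ecoeff.
  move=> <-; rewrite fineK//.
  apply: integrable_fin_num => //.
  have : P.-integrable [set: T]
      (fun w => \sum_(i < n) (cos_coeff' (X w) i)%:E)%E.
    by apply: integrable_sum => // i _; exact: icoeff.
  by apply: eq_integrable => // w _; rewrite /= sumEFin.
have cvg_int : (\int[P]_w (series (cos_coeff' (X w)) n)%:E)%E @[n --> \oo] -->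
    (\int[P]_w (cos (X w))%:E)%E.
  have := @dominated_convergence _ _ _ P setT measurableT
    (fun n w => (series (cos_coeff' (X w)) n)%:E) (fun w => (cos (X w))%:E)
    (fun w => (expR `|X w|)%:E).
  case=> //.
  - move=> n; apply/measurable_EFinP; rewrite /series/=.
    apply: measurable_sum => k.
    by apply/measurable_EFinP; exact: measurable_int (icoeff k).
  - apply/measurable_EFinP; apply: measurableT_comp mX => //.
    by apply: continuous_measurable_fun; exact: continuous_cos.
  - by apply: aeW => w _; apply: cvg_EFin; [exact: nearW|exact: cvg_cos_coeff'].
  - have := gaussian_integrable_expR_norm mX lawX.
    by apply: eq_integrable => // w _; rewrite subr0.
  - by apply: aeW => w n _; rewrite lee_fin norm_series_cos_coeff_le.
have cvg_exp : (\int[P]_w (series (cos_coeff' (X w)) n)%:E)%E @[n --> \oo] -->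
    (expR (- (s ^+ 2 / 2)))%:E.
  under eq_fun do rewrite Eseries.
  by apply: cvg_EFin; [exact: nearW|exact: is_cvg_series_exp_coeff].
by rewrite /Rintegral (cvg_unique _ cvg_int cvg_exp).
Qed.

(** Trigonometric polynomials with arbitrary real frequencies. The phase [b] makes cosines cover
    sines and constants as well. *)
Inductive trig (R : realType) : (R -> R) -> Prop :=
| trig_cos a b : trig (fun x => cos (a * x + b))
| trig_comb c c' f g : trig f -> trig g -> trig (fun x => c * f x + c' * g x).

Section trig.
Variable R : realType.
Implicit Types (f g : R -> R) (c : R).

(** Bilinearity reduces the claim to two cosines, where the product-to-sum formula applies. *)
Lemma trigM f g : trig f -> trig g -> trig (fun x => f x * g x).
Proof.
elim=> [a b|c c' f1 f2 _ IH1 _ IH2] tg; last first.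
  have := trig_comb c c' (IH1 tg) (IH2 tg).
  by congr trig; apply/funext => x; ring.
elim: tg => [a' b'|c c' g1 g2 _ IH1 _ IH2]; last first.
  have := trig_comb c c' IH1 IH2.
  by congr trig; apply/funext => x; ring.
have := trig_comb 2^-1 2^-1
  (trig_cos (a + a') (b + b')) (trig_cos (a - a') (b - b')).
congr trig; apply/funext => x.
have -> : (a + a') * x + (b + b') = (a * x + b) + (a' * x + b') by ring.
have -> : (a - a') * x + (b - b') = (a * x + b) - (a' * x + b') by ring.
by rewrite cosD cosB; field.
Qed.

Lemma measurable_trig f : trig f -> measurable_fun [set: R] f.
Proof.
elim=> [a b|c c' g1 g2 _ m1 _ m2]; last first.
  by apply: measurable_funD; exact: measurable_funM.
apply: measurableT_comp.
  by apply: continuous_measurable_fun; exact: continuous_cos.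
by apply: measurable_funD => //; exact: measurable_funM.
Qed.

Lemma trig_bounded f : trig f -> exists M, forall x, `|f x| <= M.
Proof.
elim=> [a b|c c' g1 g2 _ [M1 h1] _ [M2 h2]].
  by exists 1 => x; rewrite ler_norml cos_geN1 cos_le1.
exists (`|c| * M1 + `|c'| * M2) => x; apply: le_trans (ler_normD _ _) _.
by rewrite !normrM lerD// ler_wpM2l.
Qed.

End trig.

(** * Approximating a step function by iterating a cubic polynomial *)

Section smoothstep.
Variable R : realType.

(* The fixed points -1 and 1 are attracting on [-1, 1] minus 0, and 0 is
   repelling, so that the iterates converge to the sign. *)
Definition smoothstep (y : R) : R := (3 * y - y ^+ 3) / 2.

Lemma smoothstepN y : smoothstep (- y) = - smoothstep y.
Proof. by rewrite /smoothstep; field. Qed.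

Lemma iter_smoothstepN n y : iter n smoothstep (- y) = - iter n smoothstep y.
Proof. by elim: n => //= n ->; rewrite smoothstepN. Qed.

(** One step shrinks the distance of z to 1 by at least the factor 1 - z/2. The last conjunct keeps
    the iterates above [y], so that this ratio stays at most 1 - y/2. *)
Lemma iter_smoothstep_bound n y : 0 < y <= 1 ->
  1 - (1 - y / 2) ^+ n <= iter n smoothstep y <= 1 /\ y <= iter n smoothstep y.
Proof.
move=> /andP[y0 y1].
elim: n => /= [|n []]; first by rewrite expr0 subrr y1 ltW.
move: (iter n smoothstep y) => z /andP[qz z1] yz; rewrite exprS.
have z0 : 0 < z by exact: lt_le_trans yz.
have E : 1 - smoothstep z = (1 - z) * (1 - z / 2) - (1 - z) * z ^+ 2 / 2.
  by rewrite /smoothstep; field.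
have sz : z <= smoothstep z.
  rewrite -subr_ge0 (_ : _ - _ = z * ((1 - z) * (1 + z)) / 2); last first.
    by rewrite /smoothstep; field.
  by rewrite divr_ge0// mulr_ge0 ?(ltW z0)// mulr_ge0//; lra.
have ss1 : smoothstep z <= 1.
  rewrite -subr_ge0 (_ : _ - _ = (1 - z) ^+ 2 * (2 + z) / 2); last first.
    by rewrite /smoothstep; field.
  by rewrite divr_ge0// mulr_ge0 ?sqr_ge0//; lra.
split; last exact: le_trans sz.
apply/andP; split=> //; rewrite lerBlDr -lerBlDl E.
apply: (@le_trans _ _ ((1 - z) * (1 - z / 2))).
  by rewrite lerBlDr lerDl divr_ge0// mulr_ge0 ?sqr_ge0//; lra.
by rewrite mulrC ler_pM//; lra.
Qed.

(** The quadratic (t^2 + t)/2 sends the possible limits -1, 0, 1 of the iterates to 0, 0, 1. *)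
Definition step_approx n (y : R) : R :=
  (iter n smoothstep y ^+ 2 + iter n smoothstep y) / 2.

Lemma step_approx_cvg (y : R) : -1 <= y <= 1 ->
  step_approx n y @[n --> \oo] --> ((0 < y)%R%:R : R).
Proof.
have cvg1 z : 0 < z <= 1 -> iter n smoothstep z @[n --> \oo] --> (1 : R).
  move=> z01.
  apply: (squeeze_cvgr (f := fun n => 1 - (1 - z / 2) ^+ n) (h := cst 1)).
  - by apply: nearW => n; exact: (iter_smoothstep_bound n z01).1.
  - rewrite -[X in _ --> X]subr0; apply: cvgB; first exact: cvg_cst.
    by apply: cvg_expr; move/andP: z01 => [z0 z1]; rewrite ger0_norm; lra.
  - exact: cvg_cst.
have cvg_step (l : R) : iter n smoothstep y @[n --> \oo] --> l ->
    step_approx n y @[n --> \oo] --> (l ^+ 2 + l) / 2.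
  move=> cl; apply: cvgM; last exact: cvg_cst.
  by apply: cvgD => //; exact: cvgM.
move=> /andP[yN1 y1]; have [y0|y0|y0] := ltgtP 0 y.
- have := cvg_step _ (cvg1 y _); rewrite y0 y1 => /(_ isT).
  by rewrite expr1n (_ : (1 + 1) / 2 = 1 :> R)//; field.
- have cN : iter n smoothstep y @[n --> \oo] --> (-1 : R).
    rewrite -[y]opprK; under eq_fun do rewrite iter_smoothstepN.
    by apply: cvgN; apply: cvg1; apply/andP; split; lra.
  by have := cvg_step _ cN; rewrite sqrrN expr1n subrr mul0r.
- have c0 : iter n smoothstep y @[n --> \oo] --> (0 : R).
    apply: cvg_near_cst; apply: nearW => n.
    rewrite -y0 iter_fix// /smoothstep.
    by rewrite mulr0 expr0n subrr mul0r.
  by have := cvg_step _ c0; rewrite expr0n addr0 mul0r.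
Qed.

(** Only polynomials without constant term are applied to [f], and [trig] is closed under products
    and linear combinations. *)
Lemma trig_step_approx n (f : R -> R) :
  trig f -> trig (fun x => step_approx n (f x)).
Proof.
move=> tf; have ts k : trig (fun x => iter k smoothstep (f x)).
  elim: k => //= k IH.
  have := trig_comb (3 / 2) (- 2^-1) IH (trigM (trigM IH IH) IH).
  by congr trig; apply/funext => x; rewrite /smoothstep; field.
have := trig_comb 2^-1 2^-1 (trigM (ts n) (ts n)) (ts n).
by congr trig; apply/funext => x; rewrite /step_approx; field.
Qed.

Lemma step_approx_bound n (y : R) : -1 <= y <= 1 -> `|step_approx n y| <= 1.
Proof.
move=> y1; have : -1 <= iter n smoothstep y <= 1.
  elim: n => //= n; move: (iter n smoothstep y) => z /andP[z0 z1].
  have hp : 0 <= (1 - z) ^+ 2 * (2 + z) by rewrite mulr_ge0 ?sqr_ge0//; lra.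
  have hn : 0 <= (1 + z) ^+ 2 * (2 - z) by rewrite mulr_ge0 ?sqr_ge0//; lra.
  by rewrite /smoothstep; apply/andP; split; lra.
rewrite /step_approx; move: (iter n smoothstep y) => z /andP[z0 z1].
have ? : 0 <= (1 - z) * (1 + z) by rewrite mulr_ge0//; lra.
by rewrite ler_norml; apply/andP; split; have := sqr_ge0 z; lra.
Qed.

End smoothstep.

(** * Bounded convergence *)

Section bounded_integrals.
Context d (T : measurableType d) (R : realType) (P : probability T R).

Lemma integrable_bounded (f : T -> R) (M : R) :
    measurable_fun [set: T] f -> (forall w, `|f w| <= M) ->
  P.-integrable [set: T] (EFin \o f).
Proof.
move=> mf fM; have : P.-integrable [set: T] (cst M%:E).
  exact: finite_measure_integrable_cst.
apply: le_integrable => //; first exact/measurable_EFinP.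
by move=> w _; rewrite lee_fin (le_trans (fM w))// ler_norm.
Qed.

Lemma bounded_convergence (f_ : nat -> T -> R) (f : T -> R) (M : R) :
    (forall n, measurable_fun [set: T] (f_ n)) ->
    (forall n w, `|f_ n w| <= M) ->
    (forall w, f_ n w @[n --> \oo] --> f w) ->
  \int[P]_w f_ n w @[n --> \oo] --> (\int[P]_w f w : R).
Proof.
move=> mf_ fM f_f; have mf : measurable_fun [set: T] f.
  by apply: (measurable_fun_cvg mf_) => w _; exact: f_f.
have := @dominated_convergence _ _ _ P setT measurableT
  (fun n w => (f_ n w)%:E) (fun w => (f w)%:E) (cst M%:E).
case.
- by move=> n; apply/measurable_EFinP.
- exact/measurable_EFinP.
- by apply: aeW => w _; apply: cvg_EFin; [exact: nearW|exact: f_f].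
- exact: finite_measure_integrable_cst.
- by apply: aeW => w n _; rewrite lee_fin.
move=> intf _ cvgf; apply: fine_cvg.
by rewrite fineK//; exact: integrable_fin_num.
Qed.

End bounded_integrals.

(** * Factorization of expectations, from cosines to half-lines *)

Section factorization.
Context d (T : measurableType d) (R : realType) (P : probability T R).
Variables (U V : T -> R).
Hypotheses (mU : measurable_fun [set: T] U) (mV : measurable_fun [set: T] V).

Definition factorizes (f g : R -> R) : Prop :=
  \int[P]_w (f (U w) * g (V w)) = \int[P]_w f (U w) * \int[P]_w g (V w).

Lemma factorizes_lim (f_ g_ : nat -> R -> R) (f g : R -> R) :
    (forall n, measurable_fun [set: R] (f_ n)) ->
    (forall n, measurable_fun [set: R] (g_ n)) ->
    (forall n x, `|f_ n x| <= 1) -> (forall n x, `|g_ n x| <= 1) ->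
    (forall x, f_ n x @[n --> \oo] --> f x) ->
    (forall x, g_ n x @[n --> \oo] --> g x) ->
  (forall n, factorizes (f_ n) (g_ n)) -> factorizes f g.
Proof.
move=> mf mg f1 g1 f_f g_g fg.
have mfU n : measurable_fun [set: T] (fun w => f_ n (U w)).
  exact: (measurableT_comp (mf n) mU).
have mgV n : measurable_fun [set: T] (fun w => g_ n (V w)).
  exact: (measurableT_comp (mg n) mV).
have cf : \int[P]_w f_ n (U w) @[n --> \oo] --> (\int[P]_w f (U w) : R).
  by apply: (@bounded_convergence _ _ _ _ _ _ 1) => // w; exact: f_f.
have cg : \int[P]_w g_ n (V w) @[n --> \oo] --> (\int[P]_w g (V w) : R).
  by apply: (@bounded_convergence _ _ _ _ _ _ 1) => // w; exact: g_g.
have cfg : \int[P]_w (f_ n (U w) * g_ n (V w)) @[n --> \oo] -->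
    (\int[P]_w (f (U w) * g (V w)) : R).
  apply: (@bounded_convergence _ _ _ _ _ _ 1).
  - by move=> n; exact: measurable_funM.
  - by move=> n w; rewrite normrM mulr_ile1.
  - by move=> w; apply: cvgM; [exact: f_f|exact: g_g].
have fgE : (fun n => \int[P]_w (f_ n (U w) * g_ n (V w))) =
    (fun n => \int[P]_w f_ n (U w) * \int[P]_w g_ n (V w)).
  by apply/funext => n; exact: fg.
by rewrite fgE in cfg; exact: (cvg_unique _ cfg (cvgM cf cg)).
Qed.

Hypothesis factorizes_cos : forall a b a' b',
  factorizes (fun x => cos (a * x + b)) (fun x => cos (a' * x + b')).

Lemma factorizes_trig (f g : R -> R) : trig f -> trig g -> factorizes f g.
Proof.
have int_trig h X : measurable_fun [set: T] X -> trig h ->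
    P.-integrable [set: T] (EFin \o (h \o X)).
  move=> mX th; have [M hM] := trig_bounded th.
  apply: (@integrable_bounded _ _ _ _ _ M).
    exact: (measurableT_comp (measurable_trig th) mX).
  by move=> w; exact: hM.
have int_trigM h k : trig h -> trig k ->
    P.-integrable [set: T] (EFin \o (fun w => h (U w) * k (V w))).
  move=> th tk; have [M hM] := trig_bounded th; have [N kN] := trig_bounded tk.
  apply: (@integrable_bounded _ _ _ _ _ (M * N)).
    apply: measurable_funM.
      exact: (measurableT_comp (measurable_trig th) mU).
    exact: (measurableT_comp (measurable_trig tk) mV).
  by move=> w; rewrite normrM ler_pM.
have lin (h k : T -> R) c c' : P.-integrable [set: T] (EFin \o h) ->
    P.-integrable [set: T] (EFin \o k) ->
    \int[P]_w (c * h w + c' * k w) = c * \int[P]_w h w + c' * \int[P]_w k w.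
  move=> ih ik; rewrite RintegralD//;
    [|exact: (integrableZl _ _ ih)|exact: (integrableZl _ _ ik)].
  by rewrite !RintegralZl.
rewrite /factorizes => tf tg.
elim: tf => [a b|c c' f1 f2 tf1 IH1 tf2 IH2]; last first.
  rewrite lin; [|exact: int_trig|exact: int_trig].
  under eq_Rintegral do rewrite mulrDl -!mulrA.
  rewrite lin; [|exact: int_trigM|exact: int_trigM].
  by rewrite IH1 IH2; ring.
elim: tg => [a' b'|c c' f1 f2 tf1 IH1 tf2 IH2]; first exact: factorizes_cos.
rewrite [X in _ = _ * X]lin; [|exact: int_trig|exact: int_trig].
under eq_Rintegral do rewrite mulrDr mulrCA [_ * (c' * _)]mulrCA.
rewrite lin; [|exact: (int_trigM _ _ (trig_cos a b) tf1)
  |exact: (int_trigM _ _ (trig_cos a b) tf2)].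
by rewrite IH1 IH2; ring.
Qed.

(** Two limits in succession. For fixed k, [step_approx] tends to the indicator of sin((x -
    z)/(k+1)) > 0; as k grows, this becomes the indicator of x > z, since the argument eventually
    lies within (-pi, pi). *)
Lemma factorizes_half_lines c e :
  factorizes (fun x => (c < x)%R%:R) (fun x => (e < x)%R%:R).
Proof.
(* A sine, written as a phase-shifted cosine to fit [trig_cos]. *)
pose y z k x : R := cos (k.+1%:R^-1 * x + (- k.+1%:R^-1 * z - pi / 2)).
have yE z k x : y z k x = sin ((x - z) / k.+1%:R).
  by rewrite -cosBpihalf /y; congr cos; rewrite addrA; congr (_ - _); ring.
have y1 z k x : -1 <= y z k x <= 1 by rewrite /y cos_geN1 cos_le1.
have ty z k : trig (y z k) by exact: trig_cos.
have msin z k : measurable_fun [set: R] (fun x => (0 < y z k x)%R%:R : R).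
  apply: (@measurable_fun_cvg _ _ _ _ (fun n x => step_approx n (y z k x))).
    by move=> n; apply: measurable_trig; exact: trig_step_approx.
  by move=> x _; exact: step_approx_cvg.
have cvgy z x : ((0 < y z k x)%R%:R : R) @[k --> \oo] --> ((z < x)%R%:R : R).
  apply: cvg_near_cst; near=> k; congr (nat_of_bool _)%:R.
  have : `|x - z| < k.+1%:R.
    apply: (@lt_trans _ _ k%:R); last by rewrite ltr_nat.
    by near: k; exact: nbhs_infty_gtr.
  rewrite yE; have k0 : 0 < k.+1%:R :> R by rewrite ltr0n.
  have pi2 : 1 <= pi :> R by have := pi_ge2 R; lra.
  rewrite ltr_norml => /andP[xzN xz1]; have [zx|xz] := ltP z x.
    apply: sin_gt0_pi; rewrite divr_gt0 ?subr_gt0//=.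
    by apply: (lt_le_trans _ pi2); rewrite ltr_pdivrMr// mul1r.
  apply/negbTE; rewrite -leNgt -[(_ - _) / _]opprK sinN oppr_le0.
  rewrite -mulNr opprB; have [<-|xz'] := eqVneq x z.
    by rewrite subrr mul0r sin0.
  have {}xz : x < z by rewrite lt_neqAle xz' xz.
  apply/ltW/sin_gt0_pi; rewrite divr_gt0 ?subr_gt0//=.
  apply: (lt_le_trans _ pi2); rewrite ltr_pdivrMr// mul1r; lra.
apply: (@factorizes_lim (fun k x => (0 < y c k x)%R%:R)
  (fun k x => (0 < y e k x)%R%:R)) => //.
- by move=> n x; rewrite normr_nat lern1 leq_b1.
- by move=> n x; rewrite normr_nat lern1 leq_b1.
move=> k; apply: (@factorizes_lim (fun n x => step_approx n (y c k x))
  (fun n x => step_approx n (y e k x))) => //.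
- by move=> n; apply: measurable_trig; exact: trig_step_approx.
- by move=> n; apply: measurable_trig; exact: trig_step_approx.
- by move=> n x; exact: step_approx_bound.
- by move=> n x; exact: step_approx_bound.
- by move=> x; exact: step_approx_cvg.
- by move=> x; exact: step_approx_cvg.
by move=> n; apply: factorizes_trig; exact: trig_step_approx.
Unshelve. all: by end_near.
Qed.

End factorization.

(** * From half-lines to Borel sets, and products of expectations *)

Section independence.
Context d (T : measurableType d) (R : realType) (P : probability T R).

(** For a fixed event [D], the Borel sets obeying the product rule form a Dynkin system containing
    the half-lines, a generating pi-system. Fixing [D] lets the argument be used for one variable at
    a time. *)
Lemma independent_half_lines (X : T -> R) (D : set T) :
    measurable_fun [set: T] X -> measurable D ->
    (forall c, P (X @^-1` `]c, +oo[ `&` D) = P (X @^-1` `]c, +oo[) * P D)%E ->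
  forall A, measurable A -> P (X @^-1` A `&` D) = (P (X @^-1` A) * P D)%E.
Proof.
move=> mX mD halfD A mA.
have mXA (B : set R) : measurable B -> measurable (X @^-1` B).
  by move=> mB; rewrite -[X @^-1` B]setTI; exact: mX.
have Pfin B : measurable B -> P B \is a fin_num by exact: fin_num_measure.
pose Q : set (set R) :=
  [set B | measurable B /\ P (X @^-1` B `&` D) = (P (X @^-1` B) * P D)%E].
suff : Q A by case.
apply: (@dynkin_induction _ (measurableTypeR R) (@RGenOInfty.G R) Q).
- exact: RGenOInfty.measurableE.
- move=> _ _ [a ->] [b ->]; exists (Num.max a b).
  apply/seteqP; split => x /=; rewrite !in_itv/= !andbT gt_max.
    by case=> -> ->.
  by move/andP.
- by split => //=; rewrite preimage_setT setTI probability_setT mul1e.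
- by move=> _ [c ->]; split.
- move=> B mB [_ IH]; split; first exact: measurableC.
  have mXB := mXA _ mB; have mXBD := measurableI _ _ (measurableC mXB) mD.
  change (P (~` (X @^-1` B) `&` D) = P (~` (X @^-1` B)) * P D)%E.
  have : P D = (P (~` (X @^-1` B) `&` D) + P (X @^-1` B `&` D))%E.
    by rewrite (measureDI P mD mXB) setDE (setIC D (~` _)) (setIC D).
  rewrite IH probability_setC//.
  move: (Pfin _ mD) (Pfin _ mXB) (Pfin _ mXBD).
  move: (P D) (P (X @^-1` B)) (P (~` (X @^-1` B) `&` D)).
  move=> [p| |] [q| |] [r| |] // _ _ _.
  by rewrite -[1%E]/(1%:E)%E -EFinB -!EFinM -EFinD => -[E]; congr EFin; lra.
- move=> F _ tF IH.
  have mF n : measurable (F n) by case: (IH n).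
  split; first exact: bigcupT_measurable.
  have tXF : trivIset [set: nat] (fun n => X @^-1` F n).
    apply/trivIsetP => n k _ _ nk; rewrite -preimage_setI.
    by move/trivIsetP: tF => ->//; rewrite preimage_set0.
  rewrite preimage_bigcup setI_bigcupl !measure_bigcup//; last first.
  - exact: trivIset_setIr.
  - by move=> n _; exact: (measurableI _ _ (mXA _ (mF n)) mD).
  - by move=> n _; exact: (mXA _ (mF n)).
  rewrite muleC -[P D]fineK ?Pfin// -nneseriesZl//.
  apply: eq_eseriesr => n _.
  by rewrite fineK ?Pfin// muleC; exact: (IH n).2.
have -> : <<s @RGenOInfty.G R >> = (measurable : set (set (measurableTypeR R))).
  exact/esym/RGenOInfty.measurableE.
exact: mA.
Qed.

(** Independence fixes the law of (U, V) on rectangles, hence makes it the product of the marginals;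
    Fubini then splits the integral. *)
Lemma independent_Rintegral (U V : {RV P >-> R}) : independent_RVs P U V ->
    P.-integrable [set: T] (fun w => (U w * V w)%:E) ->
    P.-integrable [set: T] (fun w => (U w)%:E) ->
    P.-integrable [set: T] (fun w => (V w)%:E) ->
  \int[P]_w (U w * V w) = \int[P]_w U w * \int[P]_w V w.
Proof.
move=> indep iUV iU iV.
pose nu := ((distribution P U) \x (distribution P V))%E.
pose W w := (U w, V w).
have mW : measurable_fun [set: T] W by apply/measurable_fun_pairP; split.
pose Y : {RV P >-> (R * R)%type} := mfun_Sub (mem_set mW : W \in mfun).
have lawW A : measurable A -> P (W @^-1` A) = nu A.
  move=> mA; apply/esym.
  exact: (@product_measure_unique _ _ _ _ _ _ _ (distribution P Y)).
pose f (z : R * R) := (z.1 * z.2)%:E.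
have mf : measurable_fun [set: R * R] f.
  by apply/measurable_EFinP; apply: measurable_funM.
have E : (\int[P]_w (U w * V w)%:E = \int[nu]_z f z)%E.
  exact: (integral_law mW lawW mf).
have inu : nu.-integrable [set: R * R] f.
  apply/integrableP; split => //.
  rewrite -(integral_law (f := abse \o f) mW lawW);
    last exact: measurableT_comp.
  by move/integrableP : iUV => [].
have int_dist (X : {RV P >-> R}) : P.-integrable [set: T] (fun w => (X w)%:E) ->
    (distribution P X).-integrable [set: R] (EFin \o id) /\
    (\int[distribution P X]_x x%:E = (\int[P]_w X w)%:E)%E.
  move=> iX; have mE : measurable_fun [set: R] (EFin \o @id R).
    exact/measurable_EFinP.
  split.
    apply/integrableP; split => //.
    rewrite -(integral_law (X := X) (P := P) (f := abse \o (EFin \o @id R)))//.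
      by move/integrableP : iX => [].
    exact: measurableT_comp.
  rewrite -(integral_law (X := X) (P := P) (f := EFin \o @id R))//.
  by rewrite /Rintegral fineK//; exact: integrable_fin_num.
have [iUd EU] := int_dist _ iU; have [iVd EV] := int_dist _ iV.
rewrite [LHS]/Rintegral E -integral12_prod_meas1// /fubini_F /f/=.
under eq_integral => x _.
  under eq_integral do rewrite EFinM.
  rewrite integralZl// EV.
  over.
by rewrite integralZr// EU -EFinM.
Qed.

End independence.

(** * Uncorrelated jointly Gaussian variables are independent *)

Section uncorrelated_gaussian.
Context d (T : measurableType d) (R : realType) (P : probability T R).
Variables (U V : T -> R).
Hypotheses (mU : measurable_fun [set: T] U) (mV : measurable_fun [set: T] V).
Hypotheses (UV_gaussian : jointly_gaussian P U V)
  (U_std : has_gaussian_law P U 0 1) (V_std : has_gaussian_law P V 0 1).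
Hypothesis rho0 : joint_moment P U V 1 1 = 0.

Let mS a b : measurable_fun [set: T] (fun w => a * U w + b * V w).
Proof. by apply: measurable_funD; exact: measurable_funM. Qed.

(** In the addition formula the sine part integrates to 0. With zero correlation the combination has
    variance [a ^+ 2 + b ^+ 2]. *)
Let integral_cos_comb a b c :
  \int[P]_w cos (a * U w + b * V w + c) =
  cos c * expR (- ((a ^+ 2 + b ^+ 2) / 2)).
Proof.
have [s [s0 lawS Es]] := gaussian_comb_law mU mV UV_gaussian U_std V_std a b.
have [t [t0 lawN Et]] :=
  gaussian_comb_law mU mV UV_gaussian U_std V_std (- a) (- b).
rewrite rho0 mulr0 !mul0r addr0 in Es; rewrite rho0 mulr0 !mul0r addr0 in Et.
have mtrig (h : R -> R) : continuous h ->
    measurable_fun [set: T] (fun w => h (a * U w + b * V w)).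
  move=> ch; apply: (measurableT_comp (T2 := R)); last exact: mS.
  exact: continuous_measurable_fun.
have isin : P.-integrable [set: T]
    (EFin \o (fun w => sin (a * U w + b * V w))).
  apply: (@integrable_bounded _ _ _ _ _ 1); first exact/mtrig/continuous_sin.
  by move=> w; rewrite ler_norml sin_geN1 sin_le1.
have icos : P.-integrable [set: T]
    (EFin \o (fun w => cos (a * U w + b * V w))).
  apply: (@integrable_bounded _ _ _ _ _ 1); first exact/mtrig/continuous_cos.
  by move=> w; rewrite ler_norml cos_geN1 cos_le1.
have st : s = t.
  by apply/eqP; rewrite -(@eqrXn2 _ 2)// Es Et !sqrrN.
(* a U + b V and its opposite have the same law *)
have sinS : \int[P]_w sin (a * U w + b * V w) = 0.
  pose S : {RV P >-> R} := mfun_Sub (mem_set (mS a b) : _ \in mfun).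
  have msin : measurable_fun [set: R] (fun x : R => (sin x)%:E).
    apply/measurable_EFinP; apply: continuous_measurable_fun.
    exact: continuous_sin.
  have : (\int[P]_w (sin (- a * U w + - b * V w))%:E =
          \int[distribution P S]_x (sin x)%:E)%E.
    apply: (integral_law (mS (- a) (- b)) _ msin) => A mA.
    by rewrite lawN// -st -lawS.
  rewrite -(integral_law (P := P) (mS a b) _ msin)// => /(congr1 fine) E.
  have : \int[P]_w sin (a * U w + b * V w) =
      - \int[P]_w sin (a * U w + b * V w).
    rewrite -mulN1r -RintegralZl// -[LHS]E; apply: eq_Rintegral => w _.
    by rewrite mulN1r -sinN; congr sin; ring.
  by lra.
under eq_Rintegral do rewrite cosD [cos _ * cos c]mulrC [sin _ * sin c]mulrC.
rewrite RintegralB//;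
  [|exact: (integrableZl _ _ icos)|exact: (integrableZl _ _ isin)].
rewrite !RintegralZl// sinS mulr0 subr0 (gaussian_cos (mS a b) lawS) Es.
by rewrite -mulNr.
Qed.

(** The product-to-sum formula leaves cosines of a U + a' V and a U - a' V. Both combinations have
    variance a^2 + a'^2, so the exponential is a common factor and splits, while the phases
    recombine to cos b cos b'. *)
Lemma uncorrelated_gaussian_factorizes_cos a b a' b' :
  factorizes P U V (fun x => cos (a * x + b)) (fun x => cos (a' * x + b')).
Proof.
have EU : \int[P]_w cos (a * U w + b) = cos b * expR (- (a ^+ 2 / 2)).
  have := integral_cos_comb a 0 b; rewrite expr0n addr0 => <-.
  by apply: eq_Rintegral => w _; rewrite mul0r addr0.
have EV : \int[P]_w cos (a' * V w + b') = cos b' * expR (- (a' ^+ 2 / 2)).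
  have := integral_cos_comb 0 a' b'; rewrite expr0n add0r => <-.
  by apply: eq_Rintegral => w _; rewrite mul0r add0r.
have icos c e f : P.-integrable [set: T]
    (EFin \o (fun w => cos (c * U w + e * V w + f))).
  apply: (@integrable_bounded _ _ _ _ _ 1).
    apply: (measurableT_comp (T2 := R) (f := cos)).
      by apply: continuous_measurable_fun; exact: continuous_cos.
    by apply: measurable_funD => //; exact: mS.
  by move=> w; rewrite ler_norml cos_geN1 cos_le1.
rewrite /factorizes EU EV.
transitivity (\int[P]_w (2^-1 * cos (a * U w + a' * V w + (b + b')) +
                         2^-1 * cos (a * U w + - a' * V w + (b - b')))).
  apply: eq_Rintegral => w _.
  rewrite (_ : _ + (b + b') = (a * U w + b) + (a' * V w + b')); last by ring.
  rewrite (_ : _ + (b - b') = (a * U w + b) - (a' * V w + b')); last by ring.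
  move: (a * U w + b) (a' * V w + b') => x y.
  by rewrite cosD cosB; field.
rewrite RintegralD//; [|exact: (integrableZl _ _ (icos _ _ _))..].
rewrite !RintegralZl// !integral_cos_comb sqrrN cosD cosB.
have -> : expR (- ((a ^+ 2 + a' ^+ 2) / 2)) =
    expR (- (a ^+ 2 / 2)) * expR (- (a' ^+ 2 / 2)).
  by rewrite -expRD -opprD -mulrDl.
by field.
Qed.

Lemma uncorrelated_gaussian_independent : independent_RVs P U V.
Proof.
have mUA (X : T -> R) (A : set R) :
    measurable_fun [set: T] X -> measurable A -> measurable (X @^-1` A).
  by move=> mX mA; rewrite -[X @^-1` A]setTI; exact: mX.
have half c e : P (U @^-1` `]c, +oo[ `&` V @^-1` `]e, +oo[) =
    (P (U @^-1` `]c, +oo[) * P (V @^-1` `]e, +oo[))%E.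
  have indicE' (X : T -> R) z w :
      (z < X w)%R%:R = \1_(X @^-1` `]z, +oo[) w :> R.
    rewrite indicE; congr ((nat_of_bool _)%:R).
    by apply/idP/idP; rewrite inE/= in_itv/= andbT.
  have PE (A : set T) : measurable A -> P A = (\int[P]_w \1_A w)%:E.
    move=> mA; rewrite /Rintegral integral_indic// setIT fineK//.
    exact: fin_num_measure.
  have := factorizes_half_lines mU mV uncorrelated_gaussian_factorizes_cos c e.
  rewrite /factorizes.
  under eq_Rintegral do rewrite !indicE' -[_ * _]/((_ \* _) _) -indicI.
  under [in X in _ = X * _]eq_Rintegral do rewrite indicE'.
  under [in X in _ = _ * X]eq_Rintegral do rewrite indicE'.
  have mc := mUA _ _ mU (measurable_itv `]c, +oo[).
  have me := mUA _ _ mV (measurable_itv `]e, +oo[).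
  by move=> E; rewrite !PE//; [rewrite E EFinM|exact: measurableI].
move=> A B mA mB; apply: independent_half_lines => //; first exact: mUA.
move=> c; rewrite setIC muleC; apply: independent_half_lines => //.
  exact: mUA.
by move=> e; rewrite setIC muleC.
Qed.

End uncorrelated_gaussian.

(** * Exchanging U and V, and the conclusion *)

Lemma jointly_gaussianC d (T : measurableType d) (R : realType)
    (P : probability T R) (U V : T -> R) :
  jointly_gaussian P U V -> jointly_gaussian P V U.
Proof.
move=> UV a b; have [m [s [s0 law]]] := UV b a; exists m, s; split=> // A mA.
by rewrite -law//; under eq_fun do rewrite addrC.
Qed.

Lemma joint_momentC d (T : measurableType d) (R : realType)
    (P : probability T R) (U V : T -> R) i j :
  joint_moment P U V i j = joint_moment P V U j i.
Proof. by apply: eq_Rintegral => w _; rewrite mulrC. Qed.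

Theorem theorem4p3 (d : measure_display) (T : measurableType d) (R : realType)
    (P : probability T R) (U V : {RV P >-> R}) (m2 m3 : nat)
    (m2_gt0 : (0 < m2)%N) (m3_gt0 : (0 < m3)%N)
    (UV_gaussian : jointly_gaussian P U V)
    (U_std : has_gaussian_law P U 0 1)
    (V_std : has_gaussian_law P V 0 1) :
  (* (i) *)
  (('E_P[fun w => (U w ^+ (2 * m2) * V w ^+ (2 * m3))%R]
      <= 'E_P[fun w => (U w ^+ (2 * m2 + 2) * V w ^+ (2 * m3))%R]
         * ((2 * m2 + 1)%:R^-1)%:E)%E
   /\
   ('E_P[fun w => (U w ^+ (2 * m2) * V w ^+ (2 * m3))%R]
      = 'E_P[fun w => (U w ^+ (2 * m2 + 2) * V w ^+ (2 * m3))%R]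
         * ((2 * m2 + 1)%:R^-1)%:E
    <-> independent_RVs P U V)%E)
  /\
  (* (ii) *)
  ((m3 <= m2)%N ->
   (`| 'E_P[fun w => (U w ^+ (2 * m2 + 1) * V w ^+ (2 * m3 - 1))%R] |
      < ((2 * m2 + 1)%:R / (2 * m3)%:R)%:E
        * 'E_P[fun w => (U w ^+ (2 * m2) * V w ^+ (2 * m3))%R])%E).
Proof.
have mU : measurable_fun [set: T] U by exact: measurable_funPT.
have mV : measurable_fun [set: T] V by exact: measurable_funPT.
pose M := joint_moment P U V.
have EM i j : ('E_P[fun w => (U w ^+ i * V w ^+ j)%R] = (M i j)%:E)%E.
  rewrite unlock /M /joint_moment /Rintegral fineK//.
  by apply: integrable_fin_num => //; exact: integrable_joint_moment.
have recl : forall i j, M i.+1 j = i%:R * M i.-1 j + j%:R * M 1 1 * M i j.-1.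
  exact: joint_moment_recl.
have recr i j : M i j.+1 = j%:R * M i j.-1 + i%:R * M 1 1 * M i.-1 j.
  rewrite /M !(joint_momentC P U V).
  exact: (joint_moment_recl mV mU (jointly_gaussianC UV_gaussian)).
have M00 : 0 < M 0 0 by rewrite /M joint_moment00.
have indepE : independent_RVs P U V <-> M 1 1 = 0.
  split=> [indep|]; last exact: uncorrelated_gaussian_independent.
  have V1 : \int[P]_w V w = 0.
    transitivity (M 0%N 1%N); last by rewrite recr !mul0r addr0.
    by apply: eq_Rintegral => w _; rewrite mul1r.
  have i11 := integrable_joint_moment mU mV U_std V_std 1 1.
  have i10 := integrable_joint_moment mU mV U_std V_std 1 0.
  have i01 := integrable_joint_moment mU mV U_std V_std 0 1.
  rewrite [LHS]independent_Rintegral// ?V1 ?mulr0//.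
    by apply: eq_integrable i10 => // w _; rewrite mulr1.
  by apply: eq_integrable i01 => // w _; rewrite mul1r.
(* With m3 = q + 1 and m2 = p + 1, the truncated 2 m3 - 1 is exactly 2q + 1. *)
case: m3 m3_gt0 => // q _; case: m2 m2_gt0 => // p _.
rewrite !mul2n !addn1 !addn2 !doubleS subn1 /= !EM.
have [c c0] := even_moment_step M00 recl recr p.+1 q.
set k : R := _.+1%:R; set m := M p.+1.*2 _; set m' := M _ _ => Ec.
have k0 : 0 < k by rewrite ltr0n.
(* The gap in (i) is rho^2 times the positive [c / k]: it is nonnegative, and zero only for rho =
   0. *)
have stepE : m' / k = m + M 1 1 ^+ 2 * (c / k).
  by rewrite Ec mulrDl mulrAC divff ?mul1r ?mulrA// gt_eqF.
have ck0 : 0 < c / k by rewrite divr_gt0.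
split; last first.
  move=> qp; rewrite -EFinM lte_fin -mulrA mulrCA ltr_pdivlMl ?ltr0n//.
  (* m3 <= m2 reads q + 1 <= p + 1, which is the strict q < p + 1 required here. *)
  exact: norm_odd_moment_lt M00 recl recr (joint_moment11_le1 _ _ _ _ _) qp.
rewrite -EFinM stepE; split.
  by rewrite lee_fin lerDl mulr_ge0 ?sqr_ge0// ltW.
rewrite indepE; split=> [[/eqP]|->]; last by rewrite expr0n mul0r addr0.
rewrite addrC -subr_eq subrr eq_sym mulf_eq0 sqrf_eq0 (gt_eqF ck0) orbF.
by move/eqP.
Qed.
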